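(* Let $y_d\in L^2(Q)$ and $\varrho>0$. For the unique solution $(p_\varrho,y_\varrho)\in H^{1,1}_{0;,0}(Q)\times H^{1,1}_{0;0,}(Q)$ of $$\varrho^{-1}\langle p_\varrho,q\rangle_{L^2(Q)}+b(y_\varrho,q)=0\quad\forall q\in H^{1,1}_{0;,0}(Q),$$ $$-b(z,p_\varrho)+\langle y_\varrho,z\rangle_{L^2(Q)}=\langle y_d,z\rangle_{L^2(Q)}\quad\forall z\in H^{1,1}_{0;0,}(Q),$$ there holds $$\|y_\varrho-y_d\|_{L^2(Q)}\le\|y_d\|_{L^2(Q)}.$$ If in addition $y_d\in H^{1,1}_{0;0,}(Q)$ is such that $\Box y_d\in L^2(Q)$, then $$\|y_\varrho-y_d\|_{L^2(Q)}\le\sqrt{\varrho}\,\|\Box y_d\|_{L^2(Q)}.$$ Moreover, in this case also $$\|\Box y_\varrho\|_{L^2(Q)}\le\|\Box y_d\|_{L^2(Q)}.$$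
   Context: Let $\Omega\subset\mathbb R^d$, $d\in\{1,2,3\}$, be a bounded domain (with Lipschitz boundary $\Gamma=\partial\Omega$ for $d=2,3$), $0<T<\infty$, $Q=\Omega\times(0,T)$, $\Sigma=\Gamma\times(0,T)$, $\Sigma_0=\Omega\times\{0\}$, $\Sigma_T=\Omega\times\{T\}$. $H^{1,1}_{0;0,}(Q)$ is the space of $y\in L^2(Q)$ with $\nabla_x y\in[L^2(Q)]^d$, $\partial_t y\in L^2(Q)$, $y=0$ on $\Sigma$ and $y=0$ on $\Sigma_0$. $H^{1,1}_{0;,0}(Q)$ is the analogous space with $q=0$ on $\Sigma$ and $q=0$ on $\Sigma_T$. The bilinear form is $b(y,q)=-\langle\partial_t y,\partial_t q\rangle_{L^2(Q)}+\langle\nabla_x y,\nabla_x q\rangle_{L^2(Q)}$, and $\Box=\partial_{tt}-\Delta_x$ is the wave operator in $Q$. The system above is the reduced optimality system for minimizing $\frac12\|y_\varrho-y_d\|^2_{L^2(Q)}+\frac{\varrho}{2}\|u_\varrho\|^2_{L^2(Q)}$ subject to $\Box y_\varrho=u_\varrho$ in $Q$, $y_\varrho=0$ on $\Sigma$, $y_\varrho=\partial_t y_\varrho=0$ on $\Sigma_0$, where the control is $u_\varrho=-\varrho^{-1}p_\varrho$; it has a unique solution for every $y_d\in L^2(Q)$ and $\varrho>0$.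
   Formalization: □y=f∈L²(Q) is read as b(y,q)=⟨f,q⟩ for all q∈H^{1,1}_{0;,0}(Q), which adds ∂_t y_d=0 on Σ_0 to the hypothesis on y_d; with □ taken only as a distribution in Q, the last two bounds fail together for y_d=tφ(x), φ a Dirichlet eigenfunction, as ϱ→0. *)

(* Defs.v *)
(* Points of space-time R^d x R are pairs (x, t) : 'rV[R]_d * R. *)
From HB Require Import structures.
From mathcomp Require Import all_boot all_order all_algebra.
From mathcomp Require Import all_classical all_reals all_analysis.

Set Implicit Arguments.
Unset Strict Implicit.
Unset Printing Implicit Defensive.

Import Order.TTheory GRing.Theory Num.Theory.
Import numFieldNormedType.Exports.

Local Open Scope classical_set_scope.
Local Open Scope ring_scope.

(* The sigma-algebra on row vectors generated by the coordinates; over R it is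
   the Borel sigma-algebra. *)
Section measurable_rV.
Context {d : measure_display} {T : measurableType d} (n : nat).

Let coor : 'I_n -> 'rV[T]_n -> T := fun i v => v ord0 i.

Let rV_set0 : g_sigma_preimage coor set0.
Proof. exact: sigma_algebra0. Qed.

Let rV_setC A : g_sigma_preimage coor A -> g_sigma_preimage coor (~` A).
Proof. exact: sigma_algebraC. Qed.

Let rV_bigcup (F : _^nat) : (forall i, g_sigma_preimage coor (F i)) ->
  g_sigma_preimage coor (\bigcup_i (F i)).
Proof. exact: sigma_algebra_bigcup. Qed.

HB.instance Definition _ := @isMeasurable.Build (measure_tuple_display d)
  'rV[T]_n (g_sigma_preimage coor) rV_set0 rV_setC rV_bigcup.

Lemma measurable_rV_coord (i : 'I_n) :
  measurable_fun [set: 'rV[T]_n] (fun v : 'rV[T]_n => v ord0 i).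
Proof.
move=> _ Y mY; rewrite setTI; apply: sub_sigma_algebra => /=.
rewrite -bigcup_seq/=; exists i => /=; first by rewrite mem_index_enum.
by exists Y => //; rewrite setTI.
Qed.

Lemma measurable_fun_rV d' (S : measurableType d') (f : S -> 'rV[T]_n) :
  (forall i, measurable_fun [set: S] (fun s => f s ord0 i)) ->
  measurable_fun [set: S] f.
Proof.
move=> mf; apply: (@measurability _ _ _ _ _ _
  (\big[setU/set0]_(i < n) preimage_set_system setT (coor i) measurable)) => //.
move=> _ [B + <-]; rewrite -bigcup_seq => -[i _ [C mC <-]].
by rewrite setTI; exact: mf.
Qed.

End measurable_rV.

Section lebesgue_rV.
Context {R : realType}.

Definition rV_cons n (z : R * 'rV[R]_n) : 'rV[R]_n.+1 :=
  row_mx (z.1)%:M z.2.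

Definition rV_uncons n (v : 'rV[R]_n.+1) : R * 'rV[R]_n :=
  (v ord0 ord0, \row_i v ord0 (lift ord0 i)).

Lemma rV_consK n : cancel (@rV_cons n) (@rV_uncons n).
Proof.
move=> [a v]; rewrite /rV_uncons /rV_cons /=; congr (_, _).
  have -> : (ord0 : 'I_n.+1) = lshift n (ord0 : 'I_1) by apply: val_inj.
  by rewrite (@row_mxEl _ 1 1 n) mxE eqxx.
apply/rowP => i; rewrite mxE.
rewrite (_ : lift ord0 i = rshift 1 i); last by apply: val_inj.
by rewrite (@row_mxEr _ 1 1 n).
Qed.

Lemma measurable_rV_cons n :
  measurable_fun [set: R * 'rV[R]_n] (@rV_cons n).
Proof.
apply: measurable_fun_rV => i; rewrite /rV_cons /=.
case: (@splitP 1 n i) => j ij.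
- have {ij} -> : i = lshift n j by apply: val_inj.
  under eq_fun do rewrite (@row_mxEl _ 1 1 n) mxE (ord1 j) mulr1n.
  exact: measurable_fst.
- have {ij} -> : i = rshift 1 j by apply: val_inj.
  under eq_fun do rewrite (@row_mxEr _ 1 1 n).
  exact: (measurableT_comp (measurable_rV_coord j) measurable_snd).
Qed.

Lemma measurable_rV_uncons n :
  measurable_fun [set: 'rV[R]_n.+1] (@rV_uncons n).
Proof.
apply/measurable_fun_pairP; split => /=.
  exact: measurable_rV_coord.
apply: measurable_fun_rV => i /=.
under eq_fun do rewrite mxE.
exact: measurable_rV_coord.
Qed.

Section step.
Variables (n : nat) (mu : {sigma_finite_measure set 'rV[R]_n -> \bar R}).

Definition lebesgue_rV_step : set 'rV[R]_n.+1 -> \bar R :=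
  pushforward (lebesgue_measure \x mu)%E (@rV_cons n).

Let step0 : lebesgue_rV_step set0 = 0%E.
Proof. by rewrite /lebesgue_rV_step /pushforward preimage_set0 measure0. Qed.

Let step_ge0 A : (0 <= lebesgue_rV_step A)%E.
Proof. by rewrite /lebesgue_rV_step /pushforward; exact: measure_ge0. Qed.

Let mcons F : measurable F -> measurable (@rV_cons n @^-1` F).
Proof. by move=> mF; rewrite -[X in measurable X]setTI; exact: measurable_rV_cons. Qed.

Let step_sigma_additive : semi_sigma_additive lebesgue_rV_step.
Proof.
move=> F mF tF mUF; rewrite /lebesgue_rV_step /pushforward preimage_bigcup.
apply: measure_semi_sigma_additive.
- by move=> k; exact: mcons.
- apply/trivIsetP => /= i j _ _ ij; rewrite -preimage_setI.
  by move/trivIsetP : tF => /(_ _ _ _ _ ij) ->//; rewrite preimage_set0.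
- by rewrite -preimage_bigcup; exact: mcons.
Qed.

HB.instance Definition _ := isMeasure.Build _ _ _ lebesgue_rV_step
  step0 step_ge0 step_sigma_additive.

Let step_sigma_finite : sigma_finite setT lebesgue_rV_step.
Proof.
have /sigma_finiteP[F [FT ndF Foo]] := sigma_finiteT (@lebesgue_measure R).
have /sigma_finiteP[G [GT ndG Goo]] := sigma_finiteT mu.
exists (fun k => @rV_uncons n @^-1` (F k `*` G k)).
  rewrite -preimage_bigcup (_ : \bigcup_k (F k `*` G k) = setT) ?preimage_setT//.
  rewrite -setXTT FT GT predeqE => -[x y]; split.
    by move=> [k _ []/= ? ?]; split; exists k.
  move=> [/= [i _ Fix] [j _ Gjy]]; exists (maxn i j) => //; split.
  - by move: x Fix; exact/subsetPset/ndF/leq_maxl.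
  - by move: y Gjy; exact/subsetPset/ndG/leq_maxr.
move=> k; have [mF Fk] := Foo k; have [mG Gk] := Goo k; split.
  rewrite -[X in measurable X]setTI; apply: measurable_rV_uncons => //.
  exact: measurableX.
rewrite /lebesgue_rV_step /pushforward -comp_preimage.
rewrite (_ : _ \o _ = id); last by apply/funext => z /=; rewrite rV_consK.
by rewrite preimage_id product_measure1E// lte_mul_pinfty// ge0_fin_numE.
Qed.

HB.instance Definition _ := Measure_isSigmaFinite.Build _ _ _
  lebesgue_rV_step step_sigma_finite.

End step.

Fixpoint lebesgue_rV n : {sigma_finite_measure set 'rV[R]_n -> \bar R} :=
  match n return {sigma_finite_measure set 'rV[R]_n -> \bar R} with
  | 0 => \d_(0 : 'rV[R]_0)
  | m.+1 => lebesgue_rV_step (lebesgue_rV m)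
  end.

End lebesgue_rV.

Section smooth.
Context {R : realType} {V : normedModType R}.

(* C^k on the whole space: all iterated directional derivatives up to order k
   exist everywhere and are continuous. *)
Fixpoint is_Ck (k : nat) (f : V -> R) : Prop :=
  continuous f /\
  if k is k'.+1 then
    forall v : V, (forall x, derivable f x v) /\ is_Ck k' (fun x => 'D_v f x)
  else True.

Definition smooth (f : V -> R) : Prop := forall k, is_Ck k f.

Definition test_function (U : set V) (f : V -> R) : Prop :=
  [/\ smooth f, compact (closure [set x | f x != 0]) &
      closure [set x | f x != 0] `<=` U].

End smooth.

Section domain.
Context {R : realType} {d : nat}.

Definition bdry (Om : set 'rV[R]_d) : set 'rV[R]_d := closure Om `\` Om^°.

Definition dotv (u v : 'rV[R]_d) : R := \sum_(i < d) u ord0 i * v ord0 i.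

(* Near each of its boundary points x0, Om is the strict epigraph, in some
   direction e, of a Lipschitz function of the remaining d - 1 Cartesian
   coordinates. A function of the coordinates orthogonal to e is encoded as a
   function on R^d that is invariant under translations along e. *)
Definition lipschitz_boundary (Om : set 'rV[R]_d) : Prop :=
  forall x0, bdry Om x0 ->
    exists (e : 'rV[R]_d) (g : 'rV[R]_d -> R) (k r : R),
      [/\ dotv e e = 1,
          (forall x s, g (x + s *: e) = g x),
          (forall x y, `|g x - g y| <= k * `|x - y|),
          0 < r &
          forall x, ball x0 r x -> (Om x <-> g x < dotv x e)].

Definition cylinder (Om : set 'rV[R]_d) (T : R) : set ('rV[R]_d * R) :=
  Om `*` `]0, T[.

Definition lateral (Om : set 'rV[R]_d) (T : R) : set ('rV[R]_d * R) :=
  bdry Om `*` `]0, T[.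

Definition slice (Om : set 'rV[R]_d) (t : R) : set ('rV[R]_d * R) :=
  Om `*` [set t].

End domain.

Section space_time.
Context {R : realType} {d : nat}.
Local Notation X := ('rV[R]_d * R)%type.
Implicit Types (Q S : set X) (f g : X -> R).

Definition lebesgue_xt : set X -> \bar R :=
  (lebesgue_rV d \x lebesgue_measure)%E.

HB.instance Definition _ := isMeasure.Build _ _ _ lebesgue_xt
  (@measure0 _ _ _ (lebesgue_rV d \x lebesgue_measure)%E)
  (@measure_ge0 _ _ _ (lebesgue_rV d \x lebesgue_measure)%E)
  (@measure_semi_sigma_additive _ _ _ (lebesgue_rV d \x lebesgue_measure)%E).

(* Functions on Q are represented by functions on the whole space whose values
   outside Q are irrelevant. *)
Definition L2 Q f : Prop := f \_ Q \in Lfun lebesgue_xt 2%:E.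

Definition L2norm Q f : \bar R := ('N[lebesgue_xt]_2%:E[EFin \o (f \_ Q)])%E.

Definition L2dot Q f g : R := \int[lebesgue_xt]_(z in Q) (f z * g z).

Definition dir_t : X := (0, 1).
Definition dir_x (i : 'I_d) : X := (delta_mx ord0 i, 0).

Definition weak_derivative Q (v : X) f g : Prop :=
  forall phi, test_function Q phi ->
    L2dot Q f (fun z => 'D_v phi z) = - L2dot Q g phi.

(* A function in H^{1,1}(Q), bundled with representatives of its weak
   derivatives, which are determined almost everywhere on Q. *)
Record H11 Q := MkH11 {
  H11_fun :> X -> R;
  H11_dt : X -> R;
  H11_dx : 'I_d -> X -> R;
  H11_L2 : L2 Q H11_fun;
  H11_dt_L2 : L2 Q H11_dt;
  H11_dx_L2 : forall i, L2 Q (H11_dx i);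
  H11_dtP : weak_derivative Q dir_t H11_fun H11_dt;
  H11_dxP : forall i, weak_derivative Q (dir_x i) H11_fun (H11_dx i) }.

Definition H11_cvg Q (u_ : nat -> H11 Q) (u : H11 Q) : Prop :=
  [/\ L2norm Q (u_ n \- u) @[n --> \oo] --> 0%E,
      L2norm Q (H11_dt (u_ n) \- H11_dt u) @[n --> \oo] --> 0%E &
      forall i, L2norm Q (H11_dx (u_ n) i \- H11_dx u i) @[n --> \oo] --> 0%E].

(* u = 0 on the boundary piece S in the sense of traces: u is the limit in
   H^{1,1}(Q) of functions that are smooth up to the boundary of Q and vanish
   on S. *)
Definition vanishes_on Q S (u : H11 Q) : Prop :=
  exists u_ : nat -> H11 Q,
    (forall n, smooth (u_ n : X -> R) /\ forall z, S z -> u_ n z = 0) /\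
    H11_cvg u_ u.

Definition bform Q (y q : H11 Q) : R :=
  - L2dot Q (H11_dt y) (H11_dt q)
  + \sum_(i < d) L2dot Q (H11_dx y i) (H11_dx q i).

End space_time.

Arguments L2norm {R d} Q f%_R.

Section wave.
Context {R : realType} {d : nat}.
Variables (Om : set 'rV[R]_d) (T : R).
Local Notation X := ('rV[R]_d * R)%type.
Local Notation Q := (cylinder Om T).

(* H11_init and H11_final are the spaces H^{1,1}_{0;0,}(Q) and
   H^{1,1}_{0;,0}(Q). *)
Definition H11_init (u : H11 Q) : Prop :=
  vanishes_on (lateral Om T) u /\ vanishes_on (slice Om 0) u.

Definition H11_final (u : H11 Q) : Prop :=
  vanishes_on (lateral Om T) u /\ vanishes_on (slice Om T) u.

(* For y in H^{1,1}_{0;0,}(Q), Box y = (d_tt - Delta_x) y is the functional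
   b(y, .) on H^{1,1}_{0;,0}(Q), and wave_eq y f says that it is the function
   f of L^2(Q), which is then determined almost everywhere on Q. Integration
   by parts turns b(y, q) into <d_tt y - Delta_x y, q> + <d_t y(., 0), q(., 0)>
   where q(., 0) is free, so wave_eq y f contains d_t y = 0 on Om x {0}. Without
   this initial condition Box y_d in L^2(Q) would not give |y - y_d| of order
   sqrt(rho). *)
Definition wave_eq (y : H11 Q) (f : X -> R) : Prop :=
  L2 Q f /\ forall q : H11 Q, H11_final q -> bform y q = L2dot Q f q.

End wave.

(* Main.v *)
Require Import Defs.
From mathcomp Require Import all_boot all_order all_algebra.
From mathcomp Require Import all_classical all_reals all_analysis.
From mathcomp Require Import ring lra.

Set Implicit Arguments.
Unset Strict Implicit.
Unset Printing Implicit Defensive.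

Import Order.TTheory GRing.Theory Num.Theory.
Import numFieldNormedType.Exports.

Local Open Scope classical_set_scope.
Local Open Scope ring_scope.

(** The theorem only uses the Hilbert space structure of L^2(Q). Write (.,.) and
    |.| for its inner product and norm, and e = y - y_d.

    Testing the state equation with q = p and the adjoint equation with z = y
    eliminates b(y, p) and gives the energy identity
      (e, y) = - |p|^2 / rho  <=  0.
    As y_d = y - e, this yields |y_d|^2 = |y|^2 - 2 (e, y) + |e|^2 >= |e|^2,
    the first bound.

    If moreover y_d is in H^{1,1}, vanishes initially and laterally, and
    Box y_d = f is in L^2(Q), then y_d is an admissible z, and (f, p) is
    b(y_d, p) since p is an admissible test function in the wave equation for
    y_d. So (e, y_d) = (f, p), and subtracting from the energy identity gives
      |e|^2 + |p|^2 / rho = - (f, p).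
    Expanding 0 <= |rho f + p|^2 and inserting this identity gives
      2 rho |e|^2 + |p|^2  <=  rho^2 |f|^2,
    from which both remaining bounds are read off: |e|^2 <= rho |f|^2, and
    |p| <= rho |f|, where the state equation says that Box y = - p / rho.

    What has to be supplied is the passage from the integrals that define
    [L2dot] and [L2norm] to a symmetric bilinear form and its norm, namely
    [L2dot_linearl], [L2dotC] and [L2normE]. *)

Section L2_inner_product.
Context {R : realType} {d : nat} (Q : set ('rV[R]_d * R)).
Local Notation X := ('rV[R]_d * R)%type.
Implicit Types (a : R) (f g h : X -> R).

(** Membership in L^2(Q) is a statement about the extensions by zero, so the
    integrals are moved to the whole space, where linearity and almost
    everywhere equality can be used for an arbitrary set Q. *)
Lemma L2dotE f g :
  L2dot Q f g = \int[lebesgue_xt]_z ((f \_ Q) z * (g \_ Q) z).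
Proof.
rewrite /L2dot Rintegral_mkcond; apply: eq_Rintegral => z _.
by rewrite !patchE; case: ifPn => // _; rewrite mulr0.
Qed.

Lemma L2_integrable_mul f g : L2 Q f -> L2 Q g ->
  lebesgue_xt.-integrable setT (EFin \o (fun z => (f \_ Q) z * (g \_ Q) z)).
Proof. by move=> Lf Lg; exact/Lfun1_integrable/Lfun2_mul_Lfun1. Qed.

Lemma restrict_linear a f g : (a *: f + g) \_ Q = a *: (f \_ Q) + g \_ Q.
Proof.
apply/funext => z; rewrite /= !fctE !patchE.
by case: ifPn => // _; rewrite scaler0 addr0.
Qed.

Lemma L2_linear a f g : L2 Q f -> L2 Q g -> L2 Q (a *: f + g).
Proof.
rewrite /L2 restrict_linear => Lf Lg.
have le12 : (1 <= 2%:E :> \bar R)%E by rewrite lee_fin ler1n.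
have [_ closed] := Lfun_submod_closed (@lebesgue_xt R d) le12.
exact: (closed a _ _ Lf Lg).
Qed.

(** This makes scaling a special case of the linear combinations above. *)
Lemma scaler_subr1 a f : a *: f = (a - 1) *: f + f.
Proof. by rewrite scalerBl scale1r subrK. Qed.

Lemma L2_scale a f : L2 Q f -> L2 Q (a *: f).
Proof. by move=> Lf; rewrite scaler_subr1; exact: L2_linear. Qed.

Lemma L2dotC f g : L2dot Q f g = L2dot Q g f.
Proof. by apply: eq_Rintegral => z _; rewrite mulrC. Qed.

Lemma L2dot_linearl a f g h : L2 Q f -> L2 Q g -> L2 Q h ->
  L2dot Q (a *: f + g) h = a * L2dot Q f h + L2dot Q g h.
Proof.
move=> Lf Lg Lh; rewrite !L2dotE restrict_linear.
have If := L2_integrable_mul Lf Lh; have Ig := L2_integrable_mul Lg Lh.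
rewrite -RintegralZl// -RintegralD//.
  by apply: eq_Rintegral => z _; rewrite !fctE mulrDl -mulrA.
exact: (integrableZl measurableT a If).
Qed.

Lemma L2dot_scalel a f h : L2 Q f -> L2 Q h ->
  L2dot Q (a *: f) h = a * L2dot Q f h.
Proof.
by move=> Lf Lh; rewrite scaler_subr1 L2dot_linearl// mulrBl mul1r subrK.
Qed.

Lemma L2dot_ge0 f : 0 <= L2dot Q f f.
Proof. by apply: Rintegral_ge0 => z _; rewrite -expr2 sqr_ge0. Qed.

Lemma L2normE f : L2 Q f -> L2norm Q f = (Num.sqrt (L2dot Q f f))%:E.
Proof.
move=> Lf; rewrite /L2norm unlock.
have If := L2_integrable_mul Lf Lf.
transitivity ((L2dot Q f f)%:E `^ 2^-1)%E; last first.
  by rewrite poweR_EFin powR12_sqrt// L2dot_ge0.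
congr (_ `^ _)%E; rewrite L2dotE /Rintegral fineK; last first.
  exact: integrable_fin_num.
apply: eq_integral => z _ /=.
by rewrite powR_mulrn// real_normK ?num_real// expr2.
Qed.

Lemma L2dot_ae f g h : L2 Q f -> L2 Q g -> L2 Q h ->
  {ae lebesgue_xt, forall z, Q z -> f z = g z} -> L2dot Q f h = L2dot Q g h.
Proof.
move=> Lf Lg Lh fg; rewrite !L2dotE; congr fine.
have If := L2_integrable_mul Lf Lh; have Ig := L2_integrable_mul Lg Lh.
apply: ae_eq_integral => //; [exact: measurable_int If|exact: measurable_int Ig|].
apply: filterS fg => z fgz _ /=; rewrite !patchE.
by case: ifPn => // /set_mem /fgz ->.
Qed.

End L2_inner_product.

Theorem lemma1 (R : realType) (d : nat) (Om : set 'rV[R]_d) (T rho : R)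
  (yd : 'rV[R]_d * R -> R) (p y : H11 (cylinder Om T))
  (hd : (1 <= d <= 3)%N)
  (Om_open : open Om) (Om_connected : connected Om) (Om_neq0 : Om !=set0)
  (Om_bounded : bounded_set Om)
  (Om_lipschitz : (2 <= d)%N -> lipschitz_boundary Om)
  (T_gt0 : 0 < T) (rho_gt0 : 0 < rho)
  (yd_L2 : L2 (cylinder Om T) yd)
  (p_final : H11_final p) (y_init : H11_init y)
  (state_eq : forall q : H11 (cylinder Om T), H11_final q ->
     rho^-1 * L2dot (cylinder Om T) p q + bform y q = 0)
  (adjoint_eq : forall z : H11 (cylinder Om T), H11_init z ->
     - bform z p + L2dot (cylinder Om T) y z = L2dot (cylinder Om T) yd z) :
  (L2norm (cylinder Om T) (y \- yd) <= L2norm (cylinder Om T) yd)%E /\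
  forall (yd' : H11 (cylinder Om T)) (box_yd : 'rV[R]_d * R -> R),
    {ae lebesgue_xt, forall z, cylinder Om T z -> yd' z = yd z} ->
    H11_init yd' -> wave_eq yd' box_yd ->
    (L2norm (cylinder Om T) (y \- yd)
       <= (Num.sqrt rho)%:E * L2norm (cylinder Om T) box_yd)%E /\
    exists box_y : 'rV[R]_d * R -> R,
      wave_eq y box_y /\
      (L2norm (cylinder Om T) box_y <= L2norm (cylinder Om T) box_yd)%E.
Proof.
pose Q := cylinder Om T.
have Lp : L2 Q p := H11_L2 p.
have Ly : L2 Q y := H11_L2 y.
pose e : 'rV[R]_d * R -> R := y \- yd.
have eE : e = (-1) *: yd + (y : _ -> R).
  by apply/funext => z; rewrite /e !fctE scaleN1r addrC.
have Le : L2 Q e by rewrite eE; exact: L2_linear.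
have dot_e h : L2 Q h -> L2dot Q e h = L2dot Q y h - L2dot Q yd h.
  by move=> Lh; rewrite eE L2dot_linearl// mulN1r addrC.
have energy : L2dot Q e y = - (rho^-1 * L2dot Q p p).
  have := state_eq _ p_final; have := adjoint_eq _ y_init.
  by rewrite dot_e// -/Q; lra.
have irho0 : 0 < rho^-1 by rewrite invr_gt0.
have pp0 := L2dot_ge0 Q p.
have ee : L2dot Q e e = L2dot Q e y - L2dot Q e yd.
  by rewrite dot_e// !(L2dotC Q _ e).
have eyd : L2dot Q e yd = L2dot Q y yd - L2dot Q yd yd by rewrite dot_e.
have eyy : L2dot Q e y = L2dot Q y y - L2dot Q y yd.
  by rewrite dot_e// (L2dotC Q yd).
split.
  rewrite !L2normE// lee_fin; apply: ler_wsqrtr; rewrite -/e.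
  have := L2dot_ge0 Q y; have : 0 <= rho^-1 * L2dot Q p p by rewrite mulr_ge0// ltW.
  lra.
move=> yd' f yd'E yd'_init [Lf fP].
have Lyd' : L2 Q yd' := H11_L2 yd'.
have eydf : L2dot Q e yd = L2dot Q f p.
  (* yd and its representative yd' in H^{1,1} are interchangeable in integrals. *)
  rewrite L2dotC -(L2dot_ae Lyd' yd_L2 Le yd'E) L2dotC dot_e//.
  by have := adjoint_eq _ yd'_init; rewrite fP// -/Q; lra.
(* This is 0 <= |rho f + p|^2, with 2 rho (f, p) eliminated. *)
have key : 2 * rho * L2dot Q e e + L2dot Q p p <= rho ^+ 2 * L2dot Q f f.
  have := L2dot_ge0 Q (rho *: f + (p : _ -> R)).
  have Ls := L2_linear rho Lf Lp.
  rewrite L2dot_linearl// !(L2dotC Q _ (rho *: f + _)) !L2dot_linearl//.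
  rewrite (L2dotC Q p f) -eydf.
  have -> : L2dot Q p p = - rho * L2dot Q e y by rewrite energy; field; lra.
  rewrite ee; lra.
split.
  rewrite !L2normE// -EFinM lee_fin -sqrtrM ?(ltW rho_gt0)//; apply: ler_wsqrtr.
  rewrite -(ler_pM2l rho_gt0) -/e mulrA -expr2.
  have : 0 <= rho * L2dot Q e e by rewrite mulr_ge0 ?L2dot_ge0// ltW.
  lra.
(* The state equation b(y, q) = (- p / rho, q) says that Box y = - p / rho. *)
exists (- rho^-1 *: (p : _ -> R)).
have Lb : L2 Q (- rho^-1 *: (p : _ -> R)) by exact: L2_scale.
split.
  split => // q q_final.
  rewrite L2dot_scalel//; last exact: H11_L2.
  by have := state_eq _ q_final; rewrite -/Q; lra.
rewrite !L2normE// lee_fin; apply: ler_wsqrtr.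
rewrite L2dot_scalel// L2dotC L2dot_scalel// mulrA mulrNN -expr2.
rewrite exprVn mulrC ler_pdivrMr ?exprn_gt0// mulrC.
have : 0 <= rho * L2dot Q e e by rewrite mulr_ge0 ?L2dot_ge0// ltW.
lra.
Qed.
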